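(* Let $\ell\geq 3$ be an integer and let $G$ and $H$ be graphs with $G\neq K_1$. Then the lexicographic product $G[H]$ is $\ell$-distance-balanced if and only if $G$ is $\ell$-distance-balanced.
   Context: All graphs are finite, simple, undirected and connected. $d_G$ denotes the geodesic distance in $G$ and $\mathrm{diam}(G)$ the maximum distance between pairs of vertices of $G$. For vertices $u,v$ of $G$, $W_{uv}=\{w\in V(G): d_G(w,u)<d_G(w,v)\}$. For a positive integer $\ell$, a graph $G$ with $\mathrm{diam}(G)\geq \ell$ is called $\ell$-distance-balanced if $|W_{uv}|=|W_{vu}|$ for all $u,v\in V(G)$ with $d_G(u,v)=\ell$. The lexicographic product $G[H]$ has vertex set $V(G)\times V(H)$, and $(g_1,h_1)$ and $(g_2,h_2)$ are adjacent in $G[H]$ if $g_1g_2\in E(G)$, or if $g_1=g_2$ and $h_1h_2\in E(H)$. *)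

(* Defs.v *)
From mathcomp Require Import all_boot.

Set Implicit Arguments.
Unset Strict Implicit.
Unset Printing Implicit Defensive.

(* Finite, nonempty, simple, undirected, connected graphs. *)
Record graph := Graph {
  vertex :> finType;
  edge : rel vertex;
  edge_sym : symmetric edge;
  edge_irr : irreflexive edge;
  graph_connected : forall u v : vertex, connect edge u v;
  graph_nonempty : 0 < #|vertex|
}.

Section Distance.
Variable G : graph.

Definition walk (u v : G) (n : nat) : bool :=
  [exists p : n.-tuple G, path (@edge G) u p && (last u p == v)].

Lemma ex_walk (u v : G) : exists n, walk u v n.
Proof.
have /connectP[p pathp ->] := graph_connected u v.
by exists (size p); apply/existsP; exists (in_tuple p); rewrite pathp eqxx.
Qed.

Definition dist (u v : G) : nat := ex_minn (ex_walk u v).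

Definition diam : nat := \max_(u : G) \max_(v : G) dist u v.

Definition W (u v : G) : {set G} := [set w | dist w u < dist w v].

Definition distance_balanced (l : nat) : Prop :=
  l <= diam /\ forall u v : G, dist u v = l -> #|W u v| = #|W v u|.

End Distance.

Section LexicographicProduct.
Variables G H : graph.

Definition lex_edge : rel (G * H) := fun x y =>
  edge x.1 y.1 || (x.1 == y.1) && edge x.2 y.2.

Lemma lex_edge_sym : symmetric lex_edge.
Proof.
by move=> x y; rewrite /lex_edge edge_sym eq_sym (edge_sym x.2).
Qed.

Lemma lex_edge_irr : irreflexive lex_edge.
Proof. by move=> x; rewrite /lex_edge !edge_irr andbF. Qed.

Lemma lex_connected (x y : G * H) : connect lex_edge x y.
Proof.
case: x y => [g1 h1] [g2 h2]; apply: (@connect_trans _ _ (g1, h2)).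
  have /connectP[p + ->] := graph_connected h1 h2.
  elim: p h1 => [|h p IHp] h1 /=; first by rewrite connect0.
  case/andP=> e_h /IHp; apply/connect_trans/connect1.
  by rewrite /lex_edge /= eqxx e_h orbT.
have /connectP[p + ->] := graph_connected g1 g2.
elim: p g1 => [|g p IHp] g1 /=; first by rewrite connect0.
case/andP=> e_g /IHp; apply/connect_trans/connect1.
by rewrite /lex_edge /= e_g.
Qed.

Lemma lex_nonempty : 0 < #|{: G * H}|.
Proof. by rewrite card_prod muln_gt0 !graph_nonempty. Qed.

Definition lex_product : graph :=
  Graph lex_edge_sym lex_edge_irr lex_connected lex_nonempty.

End LexicographicProduct.

(* Main.v *)
Require Import Defs.
From mathcomp Require Import all_boot.

(** A nonempty walk of [G] lifts to a walk of the same length in [G[H]] whose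
    endpoints have arbitrary second coordinates, since an edge of [G] joins two
    entire copies of [H]. Conversely a walk of [G[H]] projects to a walk of [G],
    after the steps inside a copy of [H] are dropped. So two vertices in
    different copies of [H] are as far apart as their projections
    ([dist_lex]), while two vertices in the same copy are at distance at most 2,
    going through a neighbour of their common projection ([dist_lex_fiber]);
    such a neighbour exists because [G] is connected and is not [K_1].

    Distances larger than 2 are hence the same in [G[H]] as in [G], and this
    settles the diameter condition. If [x] and [y] are at distance
    [l > 2], then the set of vertices closer to [x] than to [y] is a union of
    copies of [H], namely [W x.1 y.1 * H] ([W_lex]): replacing 0 by a distance
    of at most 2 in the copies through [x] and [y] does not reverse a comparison
    with [l]. Both sets to be compared are then scaled by the factor [#|H| > 0],
    so balance holds for [x], [y] exactly when it holds for [x.1], [y.1]. *)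

Set Implicit Arguments.
Unset Strict Implicit.
Unset Printing Implicit Defensive.

(** * Distance and walks *)

Section DistanceTheory.
Variable G : graph.
Implicit Types u v w : G.

Lemma dist_path u p : path (@edge G) u p -> dist u (last u p) <= size p.
Proof.
move=> pathp; rewrite /dist; case: ex_minnP => m _; apply.
by apply/existsP; exists (in_tuple p); rewrite pathp eqxx.
Qed.

Lemma dist_geodesic u v :
  exists p, [/\ path (@edge G) u p, last u p = v & size p = dist u v].
Proof.
rewrite /dist; case: ex_minnP => m /existsP[p /andP[pathp /eqP lastp]] _.
by exists p; rewrite size_tuple.
Qed.

Lemma distxx u : dist u u = 0.
Proof. by apply/eqP; rewrite -leqn0; exact: (@dist_path u [::]). Qed.

Lemma dist_edgel u v w : edge u v -> dist u w <= (dist v w).+1.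
Proof.
move=> euv; have [p [pathp lastp <-]] := dist_geodesic v w.
by have := @dist_path u (v :: p); rewrite /= euv pathp lastp; apply.
Qed.

Lemma dist_sym u v : dist u v = dist v u.
Proof.
suff le_dist (x y : G) : dist x y <= dist y x by apply/eqP; rewrite eqn_leq !le_dist.
have [p [pathp lastp <-]] := dist_geodesic y x.
have pathr : path (@edge G) x (rev (belast y p)).
  by rewrite -lastp rev_path (eq_path (@edge_sym G)) in pathp *.
have := dist_path pathr; rewrite size_rev size_belast.
suff -> : last x (rev (belast y p)) = y by [].
by case: p {pathp pathr} lastp => [|z p] //= _; rewrite rev_cons last_rcons.
Qed.

Lemma diam_geP l :
  reflect (exists u v, l <= dist u v) (l <= diam G).
Proof.
apply: (iffP idP) => [le_l|[u [v le_l]]]; last first.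
  apply: leq_trans le_l _; rewrite /diam.
  apply: leq_trans (leq_bigmax (F := fun u => \max_(v : G) dist u v) u).
  exact: (leq_bigmax (F := fun v => dist u v) v).
have Gpos := graph_nonempty G.
have [u eq_u] := eq_bigmax (fun u => \max_(v : G) dist u v) Gpos.
have [v eq_v] := eq_bigmax (fun v => dist u v) Gpos.
by exists u, v; rewrite -eq_v -eq_u.
Qed.

Lemma ex_neighbor u : #|G| <> 1 -> exists v, edge u v.
Proof.
move=> G_neq1.
have /card_gt1P[v [w [_ _ v_neq_w]]] : 1 < #|G|.
  by have := graph_nonempty G; case: #|G| G_neq1 => [|[|n]].
have [z z_neq_u] : exists z, z != u.
  by have [eq_vu|] := eqVneq v u; [exists w; rewrite -eq_vu eq_sym | exists v].
have /connectP[[|x p] /=] := graph_connected u z.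
  by move=> _ eq_zu; rewrite eq_zu eqxx in z_neq_u.
by case/andP=> eux _ _; exists x.
Qed.

End DistanceTheory.

(** * Distances in the lexicographic product *)

Section LexDistance.
Variables G H : graph.
Local Notation GH := (lex_product G H).
Implicit Types x y w : GH.

Lemma dist_proj_le x y : dist x.1 y.1 <= dist x y.
Proof.
have [p [pathp <- <-]] := dist_geodesic x y.
elim: p x pathp => [|z p IHp] x /=; first by rewrite distxx.
case/andP=> exz /IHp le_z; case/orP: exz => [exz|/andP[/eqP -> _]].
  exact: leq_trans (dist_edgel _ exz) _.
exact: leqW.
Qed.

(** Nonemptiness of the walk gives it a step at which the second coordinate
    switches from [x.2] to the prescribed [h]. *)
Lemma dist_lift_path x (g : G) p (h : H) :
  path (@edge G) x.1 (g :: p) ->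
  dist x ((last g p, h) : GH) <= (size p).+1.
Proof.
move=> /= /andP[exg pathp].
have pathq : path (@edge GH) x [seq (g', h) | g' <- g :: p].
  rewrite /= {1}/lex_edge /= exg /=.
  elim: p g pathp {exg} => //= g' p IHp g /andP[egg' /IHp ->].
  by rewrite /lex_edge /= egg'.
by have := dist_path pathq; rewrite /= size_map last_map.
Qed.

Lemma dist_lex x y : x.1 != y.1 -> dist x y = dist x.1 y.1.
Proof.
move=> x_neq_y; apply/eqP; rewrite eqn_leq dist_proj_le andbT.
have [[|g p] [pathp lastp <-]] := dist_geodesic x.1 y.1.
  by rewrite /= in lastp; rewrite lastp eqxx in x_neq_y.
by have := dist_lift_path y.2 pathp; rewrite -[last g p]/(last x.1 (g :: p))
     lastp -surjective_pairing.
Qed.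

Hypothesis G_neqK1 : #|G| <> 1.

(** The walk goes from the copy of [H] through [x] to a neighbouring copy and
    back; 2 is the value that makes [l = 2] exceptional. *)
Lemma dist_lex_fiber x y : x.1 = y.1 -> dist x y <= 2.
Proof.
move=> eq_xy; have [g exg] := ex_neighbor x.1 G_neqK1.
have := @dist_lift_path x g [:: x.1] y.2.
by rewrite /= exg edge_sym exg eq_xy -surjective_pairing; apply.
Qed.

(** The disjunction lets the equality be used from either side: no distance
    above 2 arises in [G[H]] within a single copy of [H]. *)
Lemma dist_lex_gt2 x y :
  (2 < dist x y) || (2 < dist x.1 y.1) -> dist x y = dist x.1 y.1.
Proof.
have [eq_xy|/dist_lex //] := eqVneq x.1 y.1.
by rewrite eq_xy distxx ltnNge (dist_lex_fiber eq_xy).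
Qed.

(** Outside the copies through [x] and [y] the distances to be compared are
    those of [G]. In the copy through [x] the distance to [x] is at most 2 and
    the distance to [y] is [dist x y > 2], so the whole copy is closer to [x];
    the copy through [y] is symmetric. *)
Lemma W_lex x y : 2 < dist x y -> W x y = setX (W x.1 y.1) setT.
Proof.
move=> xy_gt2; have eq_xy : dist x y = dist x.1 y.1.
  by apply: dist_lex_gt2; rewrite xy_gt2.
have xy1_gt2 : 2 < dist x.1 y.1 by rewrite -eq_xy.
have xy_neq : x.1 != y.1.
  by apply: contraTneq xy1_gt2 => ->; rewrite distxx.
apply/setP=> -[w1 w2]; rewrite !inE andbT /=; set w := (w1, w2) : GH.
have [eq_wx|w_neq_x] := eqVneq w1 x.1.
  rewrite (@dist_lex w y) /= eq_wx // distxx.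
  rewrite (leq_ltn_trans _ xy1_gt2) ?dist_lex_fiber //.
  by rewrite (ltn_trans _ xy1_gt2).
rewrite (@dist_lex w x) //=.
have [eq_wy|w_neq_y] := eqVneq w1 y.1; last by rewrite (@dist_lex w y).
rewrite eq_wy distxx ltn0 dist_sym; apply: negbTE; rewrite -leqNgt.
by apply: leq_trans (ltnW xy1_gt2); apply: dist_lex_fiber.
Qed.

Lemma card_W_lex x y : 2 < dist x y -> #|W x y| = #|W x.1 y.1| * #|H|.
Proof. by move=> /W_lex ->; rewrite cardsX cardsT. Qed.

Lemma balanced_lex_pair x y : 2 < dist x y ->
  #|W x y| = #|W y x| <-> #|W x.1 y.1| = #|W y.1 x.1|.
Proof.
move=> xy_gt2; have yx_gt2 : 2 < dist y x by rewrite dist_sym.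
rewrite !card_W_lex //.
have Hpos := graph_nonempty H.
by split=> [/eqP|-> //]; rewrite eqn_pmul2r // => /eqP.
Qed.

Lemma diam_lex_ge l : 2 < l -> (l <= diam GH) = (l <= diam G).
Proof.
move=> l_gt2; apply/diam_geP/diam_geP => [[x [y le_l]]|[u [v le_l]]].
  by exists x.1, y.1; rewrite -dist_lex_gt2 // (leq_trans l_gt2 le_l).
have /card_gt0P[h _] := graph_nonempty H.
exists (u, h), (v, h); exact: leq_trans le_l (dist_proj_le (u, h) (v, h)).
Qed.

End LexDistance.

(** * Distance-balance *)

Theorem theorem3p2 (l : nat) (G H : graph) (l_ge3 : 3 <= l) (G_neqK1 : #|G| <> 1) :
  distance_balanced (lex_product G H) l <-> distance_balanced G l.
Proof.
rewrite /distance_balanced diam_lex_ge //.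
split=> -[le_l bal]; split=> //.
  move=> u v uv_l.
  have /card_gt0P[h _] := graph_nonempty H.
  pose x : lex_product G H := (u, h); pose y : lex_product G H := (v, h).
  have xy_l : dist x y = l by rewrite dist_lex_gt2 //= uv_l l_ge3 orbT.
  have xy_gt2 : 2 < dist x y by rewrite xy_l.
  exact: (iffLR (balanced_lex_pair G_neqK1 xy_gt2) (bal x y xy_l)).
move=> x y xy_l; have xy_gt2 : 2 < dist x y by rewrite xy_l.
apply/(balanced_lex_pair G_neqK1 xy_gt2)/bal.
by rewrite -dist_lex_gt2 // xy_gt2.
Qed.
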